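(* For every $k\geq 3$, the prism $P_k$ over a $k$-cycle belongs to $\mathcal{G}_s^w$. In particular, for every even $n\geq 6$ there is a $3$-regular $n$-vertex graph in $\mathcal{G}_s^w$.
   Context: The prism $P_k$ over a $k$-cycle is the Cartesian product $C_k\times K_2$ (two disjoint $k$-cycles $a_1\cdots a_k$ and $b_1\cdots b_k$ plus the edges $a_ib_i$); it is $3$-regular. A finite point set $X\subseteq\mathbb{R}^2$ is strictly convex if every point of $X$ is a vertex of its convex hull, and weakly convex if $X$ lies on the boundary of its convex hull. A drawing of a graph is a map of its vertices to $\mathbb{R}^2$, edges drawn as straight segments, such that no two vertices coincide, no two edge midpoints coincide, and no edge midpoint coincides with a vertex. $\mathcal{G}_s^w$ is the class of graphs admitting a drawing whose vertex set is strictly convex and whose edge-midpoint set is weakly convex. *)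

(* Defs.v *)
From HB Require Import structures.
From mathcomp Require Import all_boot all_order all_algebra.
From mathcomp Require Import all_classical all_reals.
From mathcomp Require Import interval_inference topology normedtype convex.

Set Implicit Arguments.
Unset Strict Implicit.
Unset Printing Implicit Defensive.

Import Order.TTheory GRing.Theory Num.Theory.
Import numFieldNormedType.Exports.

Local Open Scope classical_set_scope.
Local Open Scope ring_scope.
Local Open Scope convex_scope.

Record sgraph := SGraph {
  vert :> finType;
  adj : rel vert;
  adj_sym : symmetric adj;
  adj_irr : irreflexive adj }.

Definition regular (d : nat) (G : sgraph) : Prop :=
  forall v : G, #|adj v| = d.

Section CycleGraph.
Variable k : nat.

(* The first conjunct only matters for k = 1, where ordS is the identity. *)
Definition cycle_adj : rel 'I_k :=
  fun i j => (i != j) && ((j == ordS i) || (i == ordS j)).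

Lemma cycle_adj_sym : symmetric cycle_adj.
Proof. by move=> i j; rewrite /cycle_adj eq_sym orbC. Qed.

Lemma cycle_adj_irr : irreflexive cycle_adj.
Proof. by move=> i; rewrite /cycle_adj eqxx. Qed.

Definition cycle_graph : sgraph := SGraph cycle_adj_sym cycle_adj_irr.

End CycleGraph.

Section CompleteGraph.
Variable n : nat.

Definition complete_adj : rel 'I_n := fun i j => i != j.

Lemma complete_adj_sym : symmetric complete_adj.
Proof. by move=> i j; rewrite /complete_adj eq_sym. Qed.

Lemma complete_adj_irr : irreflexive complete_adj.
Proof. by move=> i; rewrite /complete_adj eqxx. Qed.

Definition complete_graph : sgraph := SGraph complete_adj_sym complete_adj_irr.

End CompleteGraph.

Section CartesianProduct.
Variables G H : sgraph.

Definition cart_adj : rel (G * H)%type :=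
  fun x y => ((x.1 == y.1) && adj x.2 y.2) || ((x.2 == y.2) && adj x.1 y.1).

Lemma cart_adj_sym : symmetric cart_adj.
Proof.
move=> x y; rewrite /cart_adj (eq_sym y.1) (eq_sym y.2).
by rewrite (adj_sym x.1) (adj_sym x.2).
Qed.

Lemma cart_adj_irr : irreflexive cart_adj.
Proof. by move=> x; rewrite /cart_adj !adj_irr !andbF. Qed.

Definition cart_prod : sgraph := SGraph cart_adj_sym cart_adj_irr.

End CartesianProduct.

Definition prism (k : nat) : sgraph :=
  cart_prod (cycle_graph k) (complete_graph 2).

Section Plane.
Variable R : realType.
Notation plane := 'rV[R]_2.

Definition conv_hull (X : set plane) : set plane :=
  smallest (@convex_set R plane) X.

Definition boundary (A : set plane) : set plane := closure A `\` interior A.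

(* Vertices of a convex set are its extreme points. *)
Definition is_vertex (C : set plane) (p : plane) : Prop :=
  C p /\
  forall (x y : convex_lmodType plane) (t : {i01 R}),
    C x -> C y -> 0 < t%:num < 1 -> p = x <| t |> y -> x = y.

Definition strictly_convex (X : set plane) : Prop :=
  forall p, X p -> is_vertex (conv_hull X) p.

Definition weakly_convex (X : set plane) : Prop :=
  X `<=` boundary (conv_hull X).

Definition midpoint (p q : plane) : plane := 2^-1 *: (p + q).

(* Edges are straight segments, so a drawing is determined by the positions of
   the vertices; an edge is given by either orientation (u, v) or (v, u). *)
Definition is_drawing (G : sgraph) (f : G -> plane) : Prop :=
  [/\ injective f,
      forall u v u' v' : G, adj u v -> adj u' v' ->
        midpoint (f u) (f v) = midpoint (f u') (f v') ->
        (u = u' /\ v = v') \/ (u = v' /\ v = u')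
    & forall u v w : G, adj u v -> midpoint (f u) (f v) <> f w].

Definition edge_midpoints (G : sgraph) (f : G -> plane) : set plane :=
  [set m | exists u v : G, adj u v /\ m = midpoint (f u) (f v)].

Definition in_Gsw (G : sgraph) : Prop :=
  exists f : G -> plane,
    [/\ is_drawing f,
        strictly_convex (range f)
      & weakly_convex (edge_midpoints f)].

End Plane.

(* Main.v *)
Require Import Defs.
From mathcomp Require Import all_boot all_order all_algebra.
From mathcomp Require Import all_classical all_reals.
From mathcomp Require Import interval_inference topology normedtype convex.
From mathcomp Require Import zify ring lra.

Set Implicit Arguments.
Unset Strict Implicit.
Unset Printing Implicit Defensive.

Import Order.TTheory GRing.Theory Num.Theory.
Import numFieldNormedType.Exports.

Local Open Scope classical_set_scope.
Local Open Scope ring_scope.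
Local Open Scope convex_scope.

(** Number the vertices by a_i = 2i and b_i = 2i + 1 (0 <= i < k) and put vertex
    t at the point (t, t^2) of a parabola.  The vertices are strictly convex,
    and distinct pairs of points of a parabola have distinct midpoints.  For the
    edges, consider four cyclically consecutive vertices a_i, b_i, a_(i+1),
    b_(i+1): the quadratic function vanishing at a_i and b_(i+1) is affine on
    the parabola, takes the same positive value T at b_i and a_(i+1), and is
    nonpositive at the other vertices; this also holds for the wrap-around
    quadruple 2k-2, 2k-1, 0, 1.  Since b_i and a_(i+1) are not adjacent, the two
    ends of any edge have values of sum at most T, with equality on the edges
    induced by the quadruple.  These cover all edges, so that every midpoint has
    a supporting line. *)

(** * Supporting lines of convex hulls in the plane *)

Section Plane.
Variable R : realType.
Implicit Types (a b c : R) (p q m : 'rV[R]_2) (X : set 'rV[R]_2).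

Definition linform a b p : R := a * p 0 0 + b * p 0 1.

Lemma convE (x y : convex_lmodType 'rV[R]_2) (t : {i01 R}) :
  x <| t |> y = t%:num *: (x : 'rV[R]_2) + (1 - t%:num) *: (y : 'rV[R]_2).
Proof. by []. Qed.

Lemma linform_conv a b (x y : convex_lmodType 'rV[R]_2) (t : {i01 R}) :
  linform a b (x <| t |> y) =
  t%:num * linform a b x + (1 - t%:num) * linform a b y.
Proof. by rewrite convE /linform !mxE; ring. Qed.

Lemma linform_midpoint a b p q :
  linform a b (midpoint p q) = 2^-1 * (linform a b p + linform a b q).
Proof. by rewrite /linform !mxE; ring. Qed.

Lemma conv_hull_halfplane a b c X :
  (forall p, X p -> linform a b p <= c) ->
  forall p, conv_hull X p -> linform a b p <= c.
Proof.
move=> Xc; apply: smallest_sub => // x y t /set_mem /= xc /set_mem /= yc.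
apply/mem_set => /=; rewrite linform_conv.
have t0 : 0 <= t%:num by [].
have t1 : t%:num <= 1 by [].
by nra.
Qed.

(** As [b != 0], moving [m] vertically in the direction of the sign of [b] increases the form beyond
    [c], out of a half-plane containing the hull; so no ball around [m] lies in the hull. *)
Lemma boundary_support a b c X m : b != 0 ->
  (forall p, X p -> linform a b p <= c) ->
  X m -> linform a b m = c -> boundary (conv_hull X) m.
Proof.
move=> b0 Xc Xm mc; split; first by apply: subset_closure; apply: sub_gen_smallest.
rewrite /interior => /nbhs_ballP[e /= e0 eX].
have : linform a b (m + (e / 2 * Num.sg b) *: delta_mx 0 1) <= c.
  apply: (conv_hull_halfplane Xc); apply: eX.
  split=> // i j; rewrite /ball /= !mxE opprD addrA subrr sub0r normrN.
  rewrite 2!normrM normr_sg b0 mulr1 gtr0_norm ?divr_gt0//.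
  by rewrite normr_nat; case: (_ && _) => /=; lra.
rewrite -mc /linform !mxE /= mulr0 addr0 mulr1 mulrDr addrA gerDl.
by rewrite mulrCA (mulrC b) -normrEsg pmulr_rle0 ?divr_gt0// leNgt normr_gt0 b0.
Qed.

(** An open half-plane together with one point of its boundary line is convex, so it contains the
    hull; a proper convex combination reaches [c] only if both ends are [p]. *)
Lemma is_vertex_support a b c X p : X p -> linform a b p = c ->
  (forall q, X q -> q = p \/ linform a b q < c) -> is_vertex (conv_hull X) p.
Proof.
move=> Xp pc Xc.
have hull : conv_hull X `<=` [set q | q = p \/ linform a b q < c].
  apply: smallest_sub => // x y t /set_mem /= xc /set_mem /= yc.
  apply/mem_set => /=.
  have [t0|t0] := eqVneq t%:num 0.
    by rewrite convE t0 scale0r add0r subr0 scale1r.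
  have [t1|t1] := eqVneq t%:num 1.
    by rewrite convE t1 scale1r subrr scale0r addr0.
  have {t0}t0 : 0 < t%:num by rewrite lt_def t0 /=.
  have {t1}t1 : t%:num < 1 by rewrite lt_neqAle t1 /=.
  case: xc yc => [->|xc] [->|yc];
    first (by left; rewrite convmm); by right; rewrite linform_conv ?pc; nra.
split; first exact: sub_gen_smallest.
move=> x y t /hull xp /hull yp /andP[t0 t1] pxy.
have : linform a b p = linform a b (x <| t |> y) by rewrite -pxy.
rewrite linform_conv pc.
case: xp => [->|xc]; case: yp => [->|yc] //; rewrite ?pc => e; exfalso; nra.
Qed.

End Plane.

(** * Points and midpoints on a parabola *)

Section Parabola.
Variable R : realType.

Definition parabola (t : nat) : 'rV[R]_2 :=
  \row_j (if j == 0 then t%:R else t%:R ^+ 2).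

Lemma linform_parabola (a b : R) t :
  linform a b (parabola t) = a * t%:R + b * t%:R ^+ 2.
Proof. by rewrite /linform !mxE. Qed.

Lemma parabola_inj : injective parabola.
Proof.
by move=> s t /rowP/(_ 0); rewrite !mxE /= => /eqP; rewrite eqr_nat => /eqP.
Qed.

(** A midpoint determines the sum and the sum of squares of the two parameters, hence the unordered
    pair. *)
Lemma parabola_midpoint_eq s t s' t' :
  midpoint (parabola s) (parabola t) = midpoint (parabola s') (parabola t') ->
  (s = s' /\ t = t') \/ (s = t' /\ t = s').
Proof.
move=> /rowP e; move: (e 0) (e 1); rewrite !mxE /= => e0 e1.
have sum_eq : t%:R = s'%:R + t'%:R - s%:R :> R by lra.
have : (s%:R - s'%:R) * (s%:R - t'%:R) == 0 :> R.
  by apply/eqP; rewrite sum_eq in e1; lra.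
rewrite mulf_eq0 !subr_eq0 !eqr_nat => /orP[] /eqP ss; [left|right]; split=> //;
  by apply/eqP; rewrite -(eqr_nat R) sum_eq ss; apply/eqP; ring.
Qed.

Lemma parabola_midpoint_neq s t w :
  s != t -> midpoint (parabola s) (parabola t) <> parabola w.
Proof.
move=> /eqP nst eq_w; apply: nst.
have : midpoint (parabola s) (parabola t) = midpoint (parabola w) (parabola w).
  by rewrite eq_w; apply/rowP => j; rewrite !mxE; field.
by case/parabola_midpoint_eq => -[-> ->].
Qed.

Lemma is_vertex_parabola (T : Type) (f : T -> nat) v :
  is_vertex (conv_hull (range (parabola \o f))) (parabola (f v)).
Proof.
pose w : R := (f v)%:R.
(* This is the tangent at parameter [w]; the point with parameter [u] falls short of the bound by
   [(w - u) ^+ 2]. *)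
apply: (@is_vertex_support R (2 * w) (-1) (w ^+ 2)); first by exists v.
  by rewrite linform_parabola -/w; ring.
move=> _ [u _ <-] /=; case: (eqVneq (f u) (f v)) => [->|ne]; [by left|right].
rewrite linform_parabola -subr_gt0.
have -> : w ^+ 2 - (2 * w * (f u)%:R + -1 * (f u)%:R ^+ 2) =
  (w - (f u)%:R) ^+ 2 by ring.
by rewrite exprn_even_gt0//= subr_eq0 eqr_nat eq_sym.
Qed.

End Parabola.

(** * Numbering the vertices of the prism; regularity *)

Section PrismCode.
Variable k : nat.

Definition prism_code (v : prism k) : nat := (v.1 : nat).*2 + (v.2 : nat).

Lemma prism_code_inj : injective prism_code.
Proof.
move=> [i s] [j r]; rewrite /prism_code /= => e.
have := ltn_ord s; have := ltn_ord r => r2 s2.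
by congr pair; apply/val_inj => /=; lia.
Qed.

(* The edges of the prism, oriented from the smaller code to the larger one. *)
Definition code_arc (s t : nat) : bool :=
  [|| ~~ odd s && (t == s.+1), t == s.+2,
      (s == 0) && (t == k.*2 - 2) | (s == 1) && (t == k.*2 - 1)]%N.

Lemma val_ordS (i : 'I_k) :
  (ordS i = (if (i.+1 == k)%N then 0 else i.+1) :> nat)%N.
Proof.
have := ltn_ord i; rewrite /=; case: eqP => [->|]; first by rewrite modnn.
by move=> ? ?; rewrite modn_small //; lia.
Qed.

Lemma code_arc_rung (i : 'I_k) (s r : 'I_2) : s != r ->
  code_arc (prism_code (i, s)) (prism_code (i, r)) ||
  code_arc (prism_code (i, r)) (prism_code (i, s)).
Proof.
case: s r => [[|[|//]] ?] [[|[|//]] ?] // _;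
  rewrite /prism_code /= addn0 addn1; apply/orP; [left|right].
all: by apply/or4P; apply: Or41; rewrite odd_double eqxx.
Qed.

Lemma code_arc_ordS (i : 'I_k) (s : 'I_2) :
  code_arc (prism_code (i, s)) (prism_code (ordS i, s)) ||
  code_arc (prism_code (ordS i, s)) (prism_code (i, s)).
Proof.
rewrite /prism_code; cbn [fst snd]; rewrite val_ordS.
have := ltn_ord s; have := ltn_ord i; case: eqP => [ik|_] i_lt s_lt; last first.
  by apply/orP; left; apply/or4P; apply: Or42; lia.
(* Wrapping from [k - 1] to 0 reverses the order of the codes. *)
apply/orP; right.
by case: s s_lt => [[|[|//]] ?] _ /=; apply/or4P; [apply: Or43|apply: Or44]; lia.
Qed.

Lemma adj_code (u v : prism k) : adj u v ->
  code_arc (prism_code u) (prism_code v) ||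
  code_arc (prism_code v) (prism_code u).
Proof.
case: u v => [i s] [j r] /orP[] /andP[/eqP /= <-]; first exact: code_arc_rung.
by case/andP=> _ /orP[] /eqP ->; last rewrite orbC; exact: code_arc_ordS.
Qed.

Lemma prism_code_lt (u : prism k) : (prism_code u < k.*2)%N.
Proof.
by case: u => i s; rewrite /prism_code /=; have := ltn_ord i;
  have := ltn_ord s; lia.
Qed.

Variable k3 : (3 <= k)%N.

Lemma ordS_neq (i : 'I_k) : ordS i != i.
Proof.
rewrite -(inj_eq val_inj) [\val (ordS i)]val_ordS /=.
by case: (i.+1 =P k) => [?|_]; apply/eqP; lia.
Qed.

(** This keeps the two cycle neighbours of a vertex apart; in a 2-cycle they would coincide. *)
Lemma ordS2_neq (i : 'I_k) : ordS (ordS i) != i.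
Proof.
rewrite -(inj_eq val_inj) [\val (ordS (ordS i))]val_ordS val_ordS /=.
by case: (i.+1 =P k) => [?|_]; case: (_ =P k) => [?|_]; apply/eqP; lia.
Qed.

Lemma eq_ord_pred (i j : 'I_k) : (j == ord_pred i) = (i == ordS j).
Proof. by rewrite eq_sym (can2_eq (@ord_predK k) (@ordSK k)). Qed.

Lemma prism_regular : regular 3 (prism k).
Proof.
move=> [i s].
pose N : seq (prism k) := [:: (i, ordS s); (ordS i, s); (ord_pred i, s)].
(* On ['I_2], [ordS] swaps the two values, so it leads to the other end of the rung. *)
have neqE (r : 'I_2) : (s != r) = (r == ordS s).
  by case: s r {N} => [[|[|//]] ?] [[|[|//]] ?].
have N_uniq : uniq N.
  rewrite /= !inE !xpair_eqE !eq_ord_pred !(eq_sym i).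
  by rewrite (negbTE (ordS_neq i)) (negbTE (ordS2_neq i)).
rewrite -[RHS]/(size N) -(card_uniqP N_uniq); apply: eq_card => -[j r].
rewrite !inE !xpair_eqE eq_ord_pred -neqE /in_mem /= /cart_adj /=.
rewrite /complete_adj /cycle_adj /= (eq_sym j i) (eq_sym r s).
have [<-|_] /= := eqVneq i j; last by rewrite -andb_orl andbC.
by rewrite (eq_sym i) (negbTE (ordS_neq i)) !andbF !orbF.
Qed.

End PrismCode.

(** * Supporting lines at the edge midpoints *)

Section PrismDrawing.
Variables (R : realType) (k : nat) (k3 : (3 <= k)%N).

(* [x] and [y] are the two vertices on the far side of the line [h = 0]. *)
Lemma arc_level_le (h : nat -> R) (T : R) x y : 0 <= T ->
  ~~ code_arc k x y -> ~~ code_arc k y x -> ~~ code_arc k x x ->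
  ~~ code_arc k y y -> h x = T -> h y = T ->
  (forall t, (t < k.*2)%N -> t != x -> t != y -> h t <= 0) ->
  forall s t, (s < k.*2)%N -> (t < k.*2)%N -> code_arc k s t -> h s + h t <= T.
Proof.
move=> T0 nxy nyx nxx nyy hx hy h0 s t sk tk st.
have hle z : (z < k.*2)%N -> (z == x) || (z == y) \/ h z <= 0.
  move=> zk; have [->|zx] := eqVneq z x; first by left.
  by have [->|zy] := eqVneq z y; [left; rewrite orbT|right; exact: h0].
have hT z : (z < k.*2)%N -> h z <= T.
  by move=> zk; case: (hle z zk) => [/orP[]/eqP->|]; lra.
case: (hle s sk) => [sxy|hs]; last by have := hT t tk; lra.
case: (hle t tk) => [txy|ht]; last by have := hT s sk; lra.
(* Both ends lie in [{x, y}], where there is no arc. *)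
by move: st; case/orP: sxy => /eqP ->; case/orP: txy => /eqP ->;
  rewrite ?(negbTE nxy) ?(negbTE nyx) ?(negbTE nxx) ?(negbTE nyy).
Qed.

Lemma arc_support s t : (s < k.*2)%N -> (t < k.*2)%N -> code_arc k s t ->
  exists a b c : R, b != 0 /\
    let h z := a * z%:R + b * z%:R ^+ 2 in
    h s + h t = c /\
    forall s' t', (s' < k.*2)%N -> (t' < k.*2)%N -> code_arc k s' t' ->
      h s' + h t' <= c.
Proof.
move=> sk tk st.
have [wrap|nwrap] := boolP ((s <= 1)%N && (t == s + (k.*2 - 2))%N).
  pose K : R := (k.*2 - 2)%:R.
  (* These are the coefficients of [(z - 1) * (z - K) - K]. The product vanishes at the codes 1 and
     [2k - 2] and equals [K] at 0 and [2k - 1]; subtracting [K] once per end turns the bound [K]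
     into [- K]. *)
  exists (- 1 - K), 1, (- K); split; first exact: oner_neq0.
  move=> h.
  have hE z : h z + K = (z%:R - 1) * (z%:R - K) by rewrite /h; ring.
  have Klast : (k.*2 - 1)%:R = K + 1 by rewrite /K natr1; congr _%:R; lia.
  split.
    have : (h s + K) + (h t + K) = K; last by lra.
    have [[-> ->]|[-> ->]] :
        (s = 0 /\ t = k.*2 - 2 \/ s = 1 /\ t = k.*2 - 1)%N by lia.
      by rewrite !hE -/K; ring.
    by rewrite !hE Klast; ring.
  move=> s' t' sk' tk' st'.
  have : (h s' + K) + (h t' + K) <= K; last by lra.
  apply: (@arc_level_le (fun z => h z + K) K 0 (k.*2 - 1)) st' => //;
    rewrite /code_arc; try lia.
  - by rewrite hE; ring.
  - by rewrite hE Klast; ring.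
  move=> z zk z0 zl; rewrite hE.
  have z1 : 1 <= z%:R :> R by rewrite ler1n; lia.
  have zK : z%:R <= K by rewrite ler_nat; lia.
  by nra.
(* Here [- (z - q) * (z - q - 3)] is 0 at [q] and [q + 3], and 2 at [q + 1] and [q + 2]. For the
   last rung, [i = k - 1], the codes [2k] and [2k + 1] are no vertices, but the bound concerns only
   codes below [2k]. *)
pose i := s./2; pose q : R := i.*2%:R.
exists (2 * q + 3), (-1), (2 + 2 * (q * (q + 3))); split.
  by rewrite oppr_eq0 oner_neq0.
move=> h.
have hE z : h z - q * (q + 3) = - (z%:R - q) * (z%:R - (q + 3)).
  by rewrite /h; ring.
have qD n : (i.*2 + n)%:R = q + n%:R by rewrite natrD.
split.
  have : (h s - q * (q + 3)) + (h t - q * (q + 3)) = 2; last by lra.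
  rewrite !hE.
  have [[-> ->]|[[-> ->]|[-> ->]]] : (s = i.*2 + 0 /\ t = i.*2 + 1 \/
      s = i.*2 + 0 /\ t = i.*2 + 2 \/ s = i.*2 + 1 /\ t = i.*2 + 3)%N.
  - by move: st nwrap; rewrite /code_arc /i; lia.
  - by rewrite !qD; ring.
  - by rewrite !qD; ring.
  - by rewrite !qD; ring.
move=> s' t' sk' tk' st'.
have : (h s' - q * (q + 3)) + (h t' - q * (q + 3)) <= 2; last by lra.
apply: (@arc_level_le (fun z => h z - q * (q + 3)) 2
          (i.*2 + 1) (i.*2 + 2)) st' => //;
  rewrite /code_arc; try lia.
- by rewrite hE qD; ring.
- by rewrite hE qD; ring.
move=> z zk z1 z2; rewrite hE.
have [zi|zi] : (z <= i.*2 \/ i.*2 + 3 <= z)%N by lia.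
  have zq : z%:R <= q by rewrite ler_nat.
  by nra.
have zq : q + 3 <= z%:R by rewrite -qD ler_nat.
by nra.
Qed.

Lemma prism_in_Gsw : in_Gsw R (prism k).
Proof.
exists (@parabola R \o @prism_code k); split; first split.
- by apply: inj_comp; [exact: parabola_inj|exact: prism_code_inj].
- move=> u v u' v' _ _ /parabola_midpoint_eq.
  by case=> -[/prism_code_inj -> /prism_code_inj ->]; [left|right].
- move=> u v w uv; apply: parabola_midpoint_neq.
  by apply: contraTneq uv => /prism_code_inj ->; rewrite adj_irr.
- by move=> _ [v _ <-]; exact: is_vertex_parabola.
move=> _ [u [v [uv ->]]].
(* Reversing an edge keeps its midpoint. *)
wlog arc : u v uv / code_arc k (prism_code u) (prism_code v).
  have /orP[] := adj_code uv; first by move=> arc /(_ u v uv arc).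
  rewrite adj_sym in uv; rewrite /midpoint addrC.
  by move=> arc /(_ v u uv arc).
have [a [b [c [b0 [eq_c le_c]]]]] :=
  arc_support (prism_code_lt u) (prism_code_lt v) arc.
apply: (@boundary_support R a b (2^-1 * c)) => //.
- move=> _ [x [y [xy ->]]].
  rewrite linform_midpoint !linform_parabola ler_pM2l ?invr_gt0 ?ltr0n//.
  have /orP[] := adj_code xy; first exact/le_c/prism_code_lt/prism_code_lt.
  by rewrite addrC; exact/le_c/prism_code_lt/prism_code_lt.
- by exists u, v.
- by rewrite linform_midpoint !linform_parabola eq_c.
Qed.

End PrismDrawing.

Theorem theorem11 (R : realType) :
  (forall k : nat, (3 <= k)%N -> in_Gsw R (prism k)) /\
  (forall n : nat, ~~ odd n -> (6 <= n)%N ->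
     exists G : sgraph, [/\ #|G| = n, regular 3 G & in_Gsw R G]).
Proof.
split=> [k k3|n n_even n6]; first exact: prism_in_Gsw.
have k3 : (3 <= n./2)%N by lia.
exists (prism n./2); split; [|exact: prism_regular|exact: prism_in_Gsw].
by rewrite card_prod !card_ord; lia.
Qed.
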